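(* Let $(P_n)_{n=0}^\infty$ be a family of real-valued polynomials on $\mathbb{R}$ with $\deg P_n=n$ for each $n$. A sequence $\tau=(\tau_n)_{n=0}^{\infty}\in\mathbb{C}^{\infty}$ is a moment functional on $(l_{\mathrm{fin}},\ast_P)$, i.e. there exists a non-negative Borel measure $\mu$ on $\mathbb{R}$ such that $$\tau_n=\int_{\mathbb{R}}P_n(x)\,d\mu(x),\quad n\in\mathbb{N}_0,$$ if and only if $\tau$ is $\ast_P$-positive (more exactly, non-negative), that is $$\tau(f\ast_P\bar f)=\sum_{n=0}^{\infty}\tau_n(f\ast_P\bar f)_n=\sum_{n=0}^{\infty}\tau_n\Big(\sum_{j,k=0}^{\infty}f_j\bar f_k\,(P_jP_k,P_n)_{\mathcal{P}}\Big)\ge 0$$ for all $f=(f_n)_{n=0}^\infty\in l_{\mathrm{fin}}$.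
   Context: $\mathbb{N}_0=\{0,1,2,\dots\}$. $\mathbb{C}^\infty$ is the space of all complex sequences $(\xi_n)_{n=0}^\infty$, and $l_{\mathrm{fin}}$ its subspace of finitely supported sequences. A sequence $\tau\in\mathbb{C}^\infty$ is identified with the linear functional $\tau(f)=\sum_{n}\tau_nf_n$ on $l_{\mathrm{fin}}$. For $f\in l_{\mathrm{fin}}$, $\bar f:=(\bar f_n)_{n=0}^\infty$. Let $I_P:l_{\mathrm{fin}}\to\mathbb{C}[x]$ be the linear bijection $(I_Pf)(x)=\sum_{n=0}^\infty f_nP_n(x)$. The product $\ast_P$ on $l_{\mathrm{fin}}$ is $f\ast_Pg:=I_P^{-1}(I_Pf\cdot I_Pg)$. The scalar product $(\cdot,\cdot)_{\mathcal{P}}$ on $\mathbb{C}[x]$ is the one for which $(P_n)_{n=0}^\infty$ is orthonormal, so $(P_jP_k,P_n)_{\mathcal{P}}$ is the coefficient of $P_n$ in the expansion of $P_jP_k$ in the basis $(P_m)_{m\ge0}$. The integral representation presupposes that every $P_n$ is $\mu$-integrable. *)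

(* Defs.v *)
From mathcomp Require Import all_boot all_order all_algebra.
From mathcomp Require Import finmap complex.
From mathcomp Require Import all_classical all_reals all_analysis.

Set Implicit Arguments.
Unset Strict Implicit.
Unset Printing Implicit Defensive.

Import Order.TTheory GRing.Theory Num.Theory.

Local Open Scope classical_set_scope.
Local Open Scope ring_scope.
Local Open Scope complex_scope.

Notation l_fin R := {fsfun nat -> complex R with 0%R}.

Section Definitions.
Variable R : realType.
Implicit Types (P : nat -> {poly R}) (tau : nat -> R[i]) (f g : l_fin R).

Definition conj_fin f : l_fin R := [fsfun n in finsupp f => (f n)^*].

(* All sums over [[set: nat]] are finite-support sums: their terms vanish
   outside the finite support of an element of [l_fin R]. *)
Definition functional tau f : R[i] := \sum_(n \in [set: nat]) tau n * f n.

Definition complexify (p : {poly R}) : {poly R[i]} :=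
  map_poly (real_complex R) p.

Definition I_P P f : {poly R[i]} :=
  \sum_(n \in [set: nat]) f n *: complexify (P n).

(* [I_P P] is bijective when [P n] has degree [n] for all [n] (see [I_P_bij]);
   the default value [[fsfun]] is then irrelevant. *)
Definition I_P_inv P : {poly R[i]} -> l_fin R :=
  'pinv_(fun=> [fsfun]) [set: l_fin R] (I_P P).

Definition star P f g : l_fin R := I_P_inv P (I_P P f * I_P P g).

(* The scalar product of complex polynomials making [P] orthonormal
   (see [dotP_orthonormal]). *)
Definition dotP P (p q : {poly R[i]}) : R[i] :=
  \sum_(n \in [set: nat]) I_P_inv P p n * (I_P_inv P q n)^*.

Definition moment_functional P tau : Prop :=
  exists mu : {measure set (measurableTypeR R) -> \bar R}, forall n,
    mu.-integrable [set: R] (fun x => (P n).[x]%:E) /\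
    tau n = (\int[mu]_x (P n).[x])%:C.

(* In [R[i]], [0 <= z] means that [z] is real and non-negative. *)
Definition star_positive P tau : Prop :=
  forall f, 0 <= functional tau (star P f (conj_fin f)).

Lemma conj_finE f n : conj_fin f n = (f n)^*.
Proof.
by rewrite /conj_fin fsfunE; case: finsuppP => // _; rewrite rmorph0.
Qed.

Lemma fsbig_lfin (V : nmodType) (N : nat) (F : nat -> V) :
  (forall n, (N <= n)%N -> F n = 0) ->
  \sum_(n \in [set: nat]) F n = \sum_(n < N) F n.
Proof.
move=> F0; rewrite (fsbigE (iota 0 N)) ?iota_uniq //.
  rewrite -(big_mkord xpredT F) /index_iota subn0.
  by apply: eq_bigl => i; rewrite in_setT.
by move=> i _; rewrite mem_iota add0n /= -leqNgt; apply: F0.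
Qed.

Lemma lfin_bound f : exists N, forall n, (N <= n)%N -> f n = 0.
Proof.
exists (\max_(i <- finsupp f) i).+1 => n ltn.
apply: fsfun_dflt; apply/negP => nf.
have : (n <= \max_(i <- finsupp f) i)%N.
  by apply: (leq_bigmax_seq (F := id)).
by rewrite leqNgt ltn.
Qed.

Section Basis.
Variable P : nat -> {poly R}.
Hypothesis degP : forall n, size (P n) = n.+1.

Let size_cP n : size (complexify (P n)) = n.+1.
Proof. by rewrite size_map_poly degP. Qed.

Lemma I_P_ord f N : (forall n, (N <= n)%N -> f n = 0) ->
  I_P P f = \sum_(n < N) f n *: complexify (P n).
Proof. by move=> f0; apply: fsbig_lfin => n /f0 ->; rewrite scale0r. Qed.

Lemma basis_free N (a : nat -> R[i]) :
  \sum_(n < N) a n *: complexify (P n) = 0 -> forall n, (n < N)%N -> a n = 0.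
Proof.
elim: N => // N IH; rewrite big_ord_recr /= => s0.
have aN : a N = 0.
  move/(congr1 (fun p : {poly R[i]} => p`_N)): s0.
  rewrite coefD coefZ coef0 nth_default ?add0r; last first.
    apply: (leq_trans (size_sum _ _ _)); apply/bigmax_leqP => i _.
    by apply: (leq_trans (size_scale_leq _ _)); rewrite size_cP.
  have -> : (complexify (P N))`_N = lead_coef (complexify (P N)).
    by rewrite lead_coefE size_cP.
  move/eqP; rewrite mulf_eq0 => /orP[/eqP //|].
  by rewrite lead_coef_eq0 -size_poly_eq0 size_cP.
move: s0; rewrite aN scale0r addr0 => /IH IHN n.
by rewrite ltnS leq_eqVlt => /orP[/eqP -> //|]; apply: IHN.
Qed.

Lemma basis_gen N (q : {poly R[i]}) : (size q <= N)%N ->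
  exists a : nat -> R[i], q = \sum_(n < N) a n *: complexify (P n).
Proof.
elim: N q => [|N IH] q.
  by rewrite leqn0 size_poly_eq0 => /eqP ->; exists (fun=> 0); rewrite big_ord0.
move=> sq; set Q := complexify (P N).
have QN : Q`_N != 0.
  have -> : Q`_N = lead_coef Q by rewrite lead_coefE size_cP.
  by rewrite lead_coef_eq0 -size_poly_eq0 size_cP.
have : (size (q - (q`_N / Q`_N) *: Q)%R <= N)%N.
  apply/leq_sizeP => j; rewrite leq_eqVlt => /orP[/eqP <-|Nj].
    by rewrite coefB coefZ divfK // subrr.
  rewrite coefB coefZ (nth_default _ (leq_trans sq Nj)).
  by rewrite (nth_default _ (_ : size Q <= j)%N) ?size_cP // mulr0 subr0.
move=> /IH [a qE].
exists (fun n => if n == N then q`_N / Q`_N else a n).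
rewrite big_ord_recr /= eqxx -/Q; apply/eqP; rewrite -subr_eq; apply/eqP.
by rewrite qE; apply: eq_bigr => i _; rewrite ltn_eqF.
Qed.

Lemma I_P_inj : injective (I_P P).
Proof.
move=> f g; have [Nf Hf] := lfin_bound f; have [Ng Hg] := lfin_bound g.
pose N := maxn Nf Ng.
have {}Hf n : (N <= n)%N -> f n = 0 by rewrite geq_max => /andP[/Hf].
have {}Hg n : (N <= n)%N -> g n = 0 by rewrite geq_max => /andP[_ /Hg].
rewrite (I_P_ord Hf) (I_P_ord Hg) => /eqP; rewrite -subr_eq0 -sumrB => /eqP.
under eq_bigr do rewrite -scalerBl.
move=> /(@basis_free _ (fun n => f n - g n)) fg; apply/fsfunP => n.
have [/fg/eqP|/[dup] /Hf -> /Hg -> //] := ltnP n N.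
by rewrite subr_eq0 => /eqP.
Qed.

Lemma I_P_bij : set_bij [set: l_fin R] [set: {poly R[i]}] (I_P P).
Proof.
split=> // [f g _ _|q _]; first exact: I_P_inj.
have [a ->] := basis_gen (leqnn (size q)).
set N := size q.
pose f : l_fin R := [fsfun n in [fset k in iota 0 N]%fset => a n].
have fE n : f n = if (n < N)%N then a n else 0.
  by rewrite /f fsfunE !inE mem_iota add0n.
exists f => //.
rewrite (@I_P_ord f N) => [|n]; last by rewrite fE ltnNge => ->.
by apply: eq_bigr => i _; rewrite fE ltn_ord.
Qed.

Lemma I_PK : cancel (I_P P) (I_P_inv P).
Proof.
by move=> f; apply: pinvKV; rewrite ?inE // => x y _ _; apply: I_P_inj.
Qed.

Lemma I_P_invK : cancel (I_P_inv P) (I_P P).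
Proof.
have [_ _ surj] := I_P_bij.
by move=> q; apply: pinvK; rewrite inE; apply: surj.
Qed.

Lemma dotP_orthonormal m n :
  dotP P (complexify (P m)) (complexify (P n)) = (m == n)%:R.
Proof.
have coord k l : I_P_inv P (complexify (P k)) l = (l == k)%:R.
  pose e : l_fin R := [fsfun l in [fset k]%fset => 1].
  have eE j : e j = (j == k)%:R by rewrite /e fsfunE inE; case: eqP.
  rewrite -eE; congr (fun_of_fsfun _ _); rewrite -[RHS]I_PK.
  congr (I_P_inv P _); rewrite (@I_P_ord e k.+1) => [|j kj].
    rewrite big_ord_recr /= eE eqxx scale1r big1 ?add0r // => i _.
    by rewrite eE ltn_eqF // scale0r.
  by rewrite eE gtn_eqF.
rewrite /dotP (@fsbig_lfin _ m.+1) => [|j mj].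
  rewrite big_ord_recr /= !coord eqxx big1 ?add0r ?mul1r ?rmorph_nat //.
  by move=> i _; rewrite coord ltn_eqF // mul0r.
by rewrite coord gtn_eqF // mul0r.
Qed.

End Basis.
End Definitions.

(* Main.v *)
(** Only "positive implies moment" is deep; it is Hamburger's theorem for the
    real functional [L p = tau (I_P^-1 p)], which is non-negative on squares.
    - A real polynomial that is non-negative on the line is a sum of squares
      (subtract the minimum, divide by the square of the linear factor there,
      induct), so [L] is non-negative on non-negative polynomials.
    - As in M. Riesz's extension theorem, [L] extends positively, one function
      at a time, to the indicators of the half-lines ]-oo, q] with [q] rational;
      call [F q] the value chosen there.
    - The generalized inverse [quantile F] of [F] pushes Lebesgue measure on
      ]0, L 1[ to a measure [mu] of mass [L 1].  Using the quantile function
      rather than the distribution function avoids regularizing [F] at its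
      jumps.  Lower sums give [\int g dmu <= L g] for every polynomial [g >= 0].
    - Thus [D p = L p - \int p dmu] is non-negative on squares and [D 1 = 0], so
      the Cauchy-Schwarz inequality forces [D = 0]. *)
Require Import Defs.
From HB Require Import structures.
From mathcomp Require Import all_boot all_order all_algebra.
From mathcomp Require Import finmap complex polyrcf cauchyreals ring lra.
From mathcomp Require Import all_classical all_reals all_analysis.
From mathcomp Require Import measurable_realfun.
Import Order.TTheory GRing.Theory Num.Theory.
Import numFieldNormedType.Exports.
Local Open Scope classical_set_scope.
Local Open Scope ring_scope.

Set Implicit Arguments.
Unset Strict Implicit.
Unset Printing Implicit Defensive.

(** * Non-negative polynomials are sums of squares *)

Lemma nonneg_poly_lead_gt0 (R : realType) (p : {poly R}) :
  (1 < size p)%N -> (forall x, 0 <= p.[x]) -> 0 < lead_coef p.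
Proof.
move=> sp p0; rewrite lt_neqAle eq_sym lead_coef_eq0.
rewrite -size_poly_gt0 (ltnW sp) /=.
rewrite leNgt -oppr_gt0 -lead_coefN; apply/negP => lN.
have [|n /(_ n (lexx n))] := poly_lim_infty 1 lN; first by rewrite size_polyN.
by rewrite hornerN; have := p0 n; lra.
Qed.

(** Both [p] and [p \Po - 'X] grow at [+oo], so [p] is at least [p.[0]] outside some [[- N, N]], and
    the minimum on this compact interval is global. *)
Lemma nonneg_poly_min (R : realType) (p : {poly R}) :
  (1 < size p)%N -> (forall x, 0 <= p.[x]) ->
  exists c, forall x, p.[c] <= p.[x].
Proof.
move=> sp p0.
have [a Ha] := poly_lim_infty p.[0] (nonneg_poly_lead_gt0 sp p0) sp.
have sN : size (p \Po - 'X) = size p.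
  by rewrite size_comp_poly2 // size_polyN size_polyX.
have [||b Hb] := @poly_lim_infty _ (p \Po - 'X) p.[0].
- apply: nonneg_poly_lead_gt0; first by rewrite sN.
  move=> x.
  by rewrite horner_comp p0.
- by rewrite sN.
pose N := Num.max 0 (Num.max a b).
have [N0 aN bN] : [/\ 0 <= N, a <= N & b <= N].
  by rewrite !le_max !lexx !orbT.
have NN : - N <= N by lra.
have [|c _ Hc] := @EVT_min R (fun x => p.[x]) _ _ NN.
  by apply: continuous_subspaceT; apply: continuous_horner.
exists c => x.
have c0 : p.[c] <= p.[0] by apply: Hc; rewrite in_itv /=; lra.
case: (lerP x (- N)) => xN.
  apply: le_trans c0 _; have := Hb (- x).
  by rewrite horner_comp !hornerE opprK; apply; lra.
case: (lerP x N) => xN'; first by apply: Hc; rewrite in_itv /= xN' ltW.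
by apply: le_trans c0 (Ha _ _); lra.
Qed.

Lemma nonneg_poly_sum_squares (R : realType) (p : {poly R}) :
  (forall x, 0 <= p.[x]) -> exists s : seq {poly R}, p = \sum_(q <- s) q ^+ 2.
Proof.
have [n] := ubnP (size p); elim: n p => // n IH p; rewrite ltnS => pn p0.
case: (leqP (size p) 1) => [/size1_polyC pC|sp].
  exists [:: (Num.sqrt p`_0)%:P]; rewrite big_seq1 -rmorphXn /= sqr_sqrtr.
    by rewrite -pC.
  by rewrite -horner_coef0.
have [c Hc] := nonneg_poly_min sp p0.
have /factor_theorem[q Hq] : root (p - p.[c]%:P) c.
  by rewrite rootE !hornerE subrr.
(* As [q.[x] * (x - c)] is non-negative, [q] changes sign at [c]. The constant factor [q.[c]] treats
   both signs at once: near [c], [q] would keep the sign of [q.[c]]. *)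
have q0 : q.[c] = 0.
  have qs x : 0 <= q.[x] * (x - c).
    have := congr1 (horner^~ x) Hq; rewrite !hornerE => <-.
    by rewrite subr_ge0.
  have [//|qc0] := eqVneq q.[c] 0.
  have cq : (q * q.[c]%:P).[x] @[x --> c] --> (q * q.[c]%:P).[c].
    exact: continuous_horner.
  have : 0 < (q * q.[c]%:P).[c] by rewrite !hornerE -expr2 exprn_even_gt0.
  move=> /(cvgr_gt _ cq)/nbhs_ballP[e /= e0 He].
  have : 0 < (q * q.[c]%:P).[c + e / 2].
    by apply: He; rewrite /ball /= opprD addNKr normrN gtr0_norm; lra.
  have : 0 < (q * q.[c]%:P).[c - e / 2].
    by apply: He; rewrite /ball /= opprB addrCA subrr addr0 gtr0_norm; lra.
  have := qs (c + e / 2); have := qs (c - e / 2).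
  have -> : c + e / 2 - c = e / 2 by ring.
  have -> : c - e / 2 - c = - (e / 2) by ring.
  rewrite !hornerE mulrN oppr_ge0.
  rewrite pmulr_lle0 ?pmulr_lge0 ?divr_gt0 // => qm qp.
  have [qc|qc|/esym/eqP] := ltgtP 0 q.[c]; last by rewrite (negPf qc0).
    by rewrite pmulr_lgt0 // ltNge qm.
  by rewrite !nmulr_lgt0 // => _; rewrite ltNge qp.
have /factor_theorem[r Hr] : root q c by rewrite rootE q0.
have pE : p = (Num.sqrt p.[c])%:P ^+ 2 + ('X - c%:P) ^+ 2 * r.
  rewrite -rmorphXn /= sqr_sqrtr //; apply/eqP; rewrite addrC -subr_eq Hq Hr.
  by apply/eqP; ring.
have r_off x : x != c -> 0 <= r.[x].
  move=> xc; have : 0 <= p.[x] - p.[c] by rewrite subr_ge0.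
  rewrite [in p.[x]]pE -rmorphXn /= sqr_sqrtr // !hornerE addrAC subrr add0r.
  by rewrite pmulr_rge0 // exprn_even_gt0 ?subr_eq0.
(* Dividing by the square says nothing at [c] itself; continuity carries the sign there. *)
have r0 x : 0 <= r.[x].
  have [->|/r_off //] := eqVneq x c; rewrite leNgt; apply/negP => rc.
  have cr : r.[x] @[x --> c] --> r.[c] by apply: continuous_horner.
  move: rc => /(cvgr_lt _ cr)/nbhs_ballP[e /= e0 He].
  have : r.[c + e / 2] < 0.
    by apply: He; rewrite /ball /= opprD addNKr normrN gtr0_norm; lra.
  by rewrite ltNge r_off //; apply/eqP; lra.
have r_neq0 : r != 0.
  apply: contraTneq sp => r0'; rewrite pE r0' mulr0 addr0 -rmorphXn /=.
  by rewrite -leqNgt size_polyC_leq1.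
have sr : (size r < n)%N.
  apply: leq_trans pn.
  have -> : size p = size (p - p.[c]%:P).
    rewrite size_polyDl // size_polyN; apply: leq_ltn_trans sp.
    exact: size_polyC_leq1.
  have q_neq0 : q != 0 by rewrite Hr mulf_neq0 // polyXsubC_eq0.
  by rewrite Hq Hr !size_Mmonic ?monicXsubC -?Hr // !size_XsubC !addn2 /= leqnSn.
have [s rE] := IH r sr r0.
exists ((Num.sqrt p.[c])%:P :: [seq ('X - c%:P) * q | q <- s]).
rewrite big_cons big_map {1}pE rE mulr_sumr; congr (_ + _).
by apply: eq_bigr => i _; rewrite exprMn.
Qed.

(** * Positive extension to countably many functions *)

Section PositiveExtension.
Variables (R : realType) (L : {scalar {poly R}}).

(** [a] extends [L] to the span of the polynomials and the first [size a]
    functions [f i] as a functional that is non-negative on the non-negative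
    functions of that span. *)
Definition dominated_values (f : nat -> R -> R) (a : seq R) : Prop :=
  forall (c : nat -> R) (p : {poly R}),
    (forall x, \sum_(i < size a) c i * f i x <= p.[x]) ->
    \sum_(i < size a) c i * a`_i <= L p.

(** One step of Riesz's extension. Adding an upper and a lower estimate cancels the new function, so
    domination for [a] puts the lower estimates below the upper ones; the bound [p0] provides one of
    each kind. *)
Lemma dominated_values_rcons (f : nat -> R -> R) (a : seq R) (p0 : {poly R}) :
  (forall x, `|f (size a) x| <= p0.[x]) -> dominated_values f a ->
  exists b, dominated_values f (rcons a b).
Proof.
set n := size a => fp0 dom.
(* The value at [f n] must be at most every element of [U] and, by [lowU], at
   least every lower estimate; the infimum of [U] satisfies both. *)
pose U := [set u | exists c : nat -> R, exists p : {poly R},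
  (forall x, f n x + \sum_(i < n) c i * f i x <= p.[x]) /\
  u = L p - \sum_(i < n) c i * a`_i].
have lowU (c' : nat -> R) (p' : {poly R}) :
    (forall x, - f n x + \sum_(i < n) c' i * f i x <= p'.[x]) ->
    lbound U (\sum_(i < n) c' i * a`_i - L p').
  move=> H' _ [c [p [H ->]]].
  rewrite lerBrDr addrAC lerBlDr -big_split /=.
  rewrite -linearD.
  have -> : \sum_(i < n) (c' i * a`_i + c i * a`_i) =
            \sum_(i < n) (c' i + c i) * a`_i.
    by apply: eq_bigr => i _; rewrite mulrDl.
  apply: (dom (fun i => c' i + c i)) => x; rewrite hornerD.
  have := lerD (H x) (H' x).
  have -> : \sum_(i < size a) (c' i + c i) * f i x =
    \sum_(i < n) c' i * f i x + \sum_(i < n) c i * f i x.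
    by rewrite -big_split; apply: eq_bigr => i _; rewrite mulrDl.
  lra.
have sum0 (g : nat -> R) : \sum_(i < n) 0 * g i = 0.
  by apply: big1 => i _; rewrite mul0r.
have U0 : U !=set0.
  exists (L p0 - \sum_(i < n) 0 * a`_i), (fun=> 0), p0; split=> // x.
  by rewrite (sum0 (f ^~ x)) addr0; apply: le_trans (ler_norm _) (fp0 x).
have Ulb : has_lbound U.
  exists (\sum_(i < n) 0 * a`_i - L p0); apply: (lowU (fun=> 0)) => x.
  rewrite (sum0 (f ^~ x)) addr0; apply: le_trans (fp0 x).
  by rewrite -normrN ler_norm.
have [b ble leb] : exists2 b, lbound U b & forall l, lbound U l -> l <= b.
  by exists (inf U); [exact: ge_inf | move=> l; exact: lb_le_inf].
exists b => c p; rewrite size_rcons => H.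
rewrite big_ord_recr /= nth_rcons ltnn eqxx.
have -> : \sum_(i < n) c i * (rcons a b)`_i = \sum_(i < n) c i * a`_i.
  by apply: eq_bigr => i _; rewrite nth_rcons ltn_ord.
have sumZ (t : R) (g : nat -> R) :
    \sum_(i < n) t * c i * g i = t * \sum_(i < n) c i * g i.
  by rewrite mulr_sumr; apply: eq_bigr => i _; rewrite mulrA.
(* Dividing by the absolute value of [c n] reduces to the coefficients [-1], where [b] is above a
   lower estimate, and [1], where [b] is below an element of [U]. *)
have [t0|t0|t0] := ltgtP (c n) 0.
- have s0 : 0 < - (c n)^-1 by rewrite oppr_gt0 invr_lt0.
  have : \sum_(i < n) (- (c n)^-1 * c i) * a`_i - L (- (c n)^-1 *: p) <= b.
    apply: leb (lowU (fun i => - (c n)^-1 * c i) _ _) => x.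
    rewrite (sumZ _ (f ^~ x)) hornerZ.
    have := H x; rewrite big_ord_recr /= -(ler_pM2l s0); apply: le_trans.
    by rewrite mulrDr mulrA (mulNr _ (c n)) mulVf ?lt_eqF // mulN1r addrC.
  rewrite sumZ linearZ /= -mulrBr -(ler_nM2l t0) mulrA (mulrN (c n)).
  rewrite mulfV ?lt_eqF //.
  lra.
- have s0 : 0 < (c n)^-1 by rewrite invr_gt0.
  have : b <= L ((c n)^-1 *: p) - \sum_(i < n) ((c n)^-1 * c i) * a`_i.
    apply: ble; exists (fun i => (c n)^-1 * c i), ((c n)^-1 *: p).
    split=> // x; rewrite (sumZ _ (f ^~ x)) hornerZ.
    have := H x; rewrite big_ord_recr /= -(ler_pM2l s0); apply: le_trans.
    by rewrite mulrDr mulrA mulVf ?gt_eqF // mul1r addrC.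
  rewrite sumZ linearZ /= -mulrBr -(ler_pM2l t0) mulrA mulfV ?gt_eqF //.
  lra.
- rewrite t0 mul0r addr0; apply: dom => x; have := H x.
  by rewrite big_ord_recr /= t0 mul0r addr0.
Qed.

Lemma dominated_values_ext (f : nat -> R -> R) :
  (forall n, exists p : {poly R}, forall x, `|f n x| <= p.[x]) ->
  (forall p : {poly R}, (forall x, 0 <= p.[x]) -> 0 <= L p) ->
  exists a : nat -> R, forall n, dominated_values f (mkseq a n).
Proof.
move=> fp L0.
have step a : exists b, dominated_values f a -> dominated_values f (rcons a b).
  (* The default [0] makes the choice function total; the iteration from the empty sequence stays
     among dominated sequences and never meets it. *)
  have [da|nda] := pselect (dominated_values f a); last by exists 0.
  have [p Hp] := fp (size a).
  by have [b Hb] := dominated_values_rcons Hp da; exists b.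
have {step}[h Hh] := choice step.
pose s k := iter k (fun a => rcons a (h a)) [::].
exists (fun k => h (s k)) => n.
have -> : mkseq (fun k => h (s k)) n = s n.
  elim: n => // n IH; rewrite /mkseq -{1}(addn1 n) iotaD map_cat -/(mkseq _ n).
  by rewrite IH /= cats1 add0n.
elim: n => [|n IH]; last exact: Hh.
move=> c p; rewrite !big_ord0 => H; apply: L0 => x.
by have := H x; rewrite !big_ord0.
Qed.

(** The functions are numbered by [choice.pickle], with the zero function at codes of no element.
    Since [s] may repeat an index, its weights are first collected by code, in [c]. *)
Lemma dominated_values_count (T : countType) (f : T -> R -> R) :
  (forall t, exists p : {poly R}, forall x, `|f t x| <= p.[x]) ->
  (forall p : {poly R}, (forall x, 0 <= p.[x]) -> 0 <= L p) ->
  exists a : T -> R, forall (s : seq (R * T)) (p : {poly R}),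
    (forall x, \sum_(i <- s) i.1 * f i.2 x <= p.[x]) ->
    \sum_(i <- s) i.1 * a i.2 <= L p.
Proof.
move=> fp L0.
pose g n x := if @choice.unpickle T n is Some t then f t x else 0.
have [|a Ha] := @dominated_values_ext g _ L0.
  move=> n; rewrite /g; case: (choice.unpickle n) => [t|]; first exact: fp.
  by exists 0 => x; rewrite normr0 horner0.
exists (fun t => a (choice.pickle t)) => s p H.
pose n := (\max_(i <- s) choice.pickle i.2).+1.
have ltn_n i : i \in s -> (choice.pickle i.2 < n)%N.
  move=> si; rewrite ltnS.
  by rewrite (leq_bigmax_seq (F := fun i : R * T => choice.pickle i.2)).
pose c k := \sum_(i <- s | choice.pickle i.2 == k) i.1.
have regroup (v : nat -> R) :
    \sum_(k < n) c k * v k = \sum_(i <- s) i.1 * v (choice.pickle i.2).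
  under eq_bigr do rewrite mulr_suml.
  rewrite (exchange_big_dep xpredT) //= [RHS]big_seq big_seq.
  apply: eq_bigr => i si.
  by rewrite (big_pred1 (Ordinal (ltn_n i si))).
have := Ha n c p; rewrite size_mkseq.
have -> : \sum_(k < n) c k * (mkseq a n)`_k = \sum_(k < n) c k * a k.
  by apply: eq_bigr => k _; rewrite nth_mkseq.
rewrite regroup; apply=> x; have -> := regroup (g ^~ x); apply: le_trans (H x).
rewrite le_eqVlt; apply/orP; left; apply/eqP/eq_bigr => i _.
by rewrite /g choice.pickleK.
Qed.

End PositiveExtension.

(** * Quantile function of the extended functional *)

Section QuantileFunction.
Variables (R : realType) (L : {scalar {poly R}}) (F : rat -> R).
Hypothesis LF : forall (s : seq (R * rat)) (p : {poly R}),
  (forall x, \sum_(i <- s) i.1 * (x <= ratr i.2)%R%:R <= p.[x]) ->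
  \sum_(i <- s) i.1 * F i.2 <= L p.

(** This and the next bounds on [F] test [LF] on one or two indicators of half-lines; here the
    indicator for [q] minus the one for [r] is at most [0]. *)
Lemma mass_homo q r : q <= r -> F q <= F r.
Proof.
move=> qr; have := LF (s := [:: (1, q); (-1, r)]) (p := 0).
rewrite big_cons big_seq1 /= mul1r mulN1r linear0 subr_le0; apply=> x.
rewrite big_cons big_seq1 /= mul1r mulN1r horner0 subr_le0 ler_nat.
by case: (leP x (ratr q)) => // xq; rewrite (le_trans xq) // ler_rat.
Qed.

Lemma mass_ge0 q : 0 <= F q.
Proof.
have := LF (s := [:: (-1, q)]) (p := 0).
rewrite big_seq1 /= mulN1r linear0 oppr_le0; apply=> x.
by rewrite big_seq1 /= mulN1r horner0 oppr_le0 ler0n.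
Qed.

Lemma mass_le q : F q <= L 1.
Proof.
have := LF (s := [:: (1, q)]) (p := 1).
rewrite big_seq1 /= mul1r; apply=> x.
by rewrite big_seq1 /= mul1r hornerC lern1 leq_b1.
Qed.

(** Chebyshev's inequality: [n%:R ^+ 2] times the indicator of []-oo, - n]] is at most [x ^+ 2]. *)
Lemma mass_lower_tail n : n%:R ^+ 2 * F (- n%:R) <= L ('X ^+ 2).
Proof.
have := LF (s := [:: (n%:R ^+ 2, - n%:R)]) (p := 'X ^+ 2).
rewrite big_seq1 /=; apply=> x; rewrite big_seq1 /= rmorphN /= ratr_nat !hornerE.
case: (leP x (- n%:R)) => [xn|_]; last by rewrite mulr0 sqr_ge0.
by rewrite mulr1; have : 0 <= n%:R :> R by []; nra.
Qed.

Lemma mass_upper_tail n : n%:R ^+ 2 * (L 1 - F n%:R) <= L ('X ^+ 2).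
Proof.
have := LF (s := [:: (- n%:R ^+ 2, n%:R)]) (p := 'X ^+ 2 - n%:R ^+ 2 *: 1).
rewrite big_seq1 linearB [L (_ *: _)]linearZ /= => H.
suff : - n%:R ^+ 2 * F n%:R <= L ('X ^+ 2) - n%:R ^+ 2 * L 1 by lra.
apply: H => x.
rewrite big_seq1 /= ratr_nat !hornerE.
case: (leP x n%:R) => [xn|xn]; first by rewrite mulr1 lerDr sqr_ge0.
rewrite mulr0; have : 0 <= n%:R :> R by []; nra.
Qed.

Lemma exists_nat_sqr (a : R) e : 0 < e ->
  exists2 n : nat, (0 < n)%N & a < n%:R ^+ 2 * e.
Proof.
move=> e0; exists (Num.truncn (`|a| / e)).+1 => //.
have := truncnS_gt (`|a| / e); rewrite ltr_pdivrMr //.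
move=> /(le_lt_trans (ler_norm a))/lt_le_trans; apply.
by rewrite ler_pM2r // expr2 ler_peMr // ler1n.
Qed.

(** No mass escapes to [-oo], by the Chebyshev bound. With the mirror image [mass_gt], this puts
    []0, L 1[] inside [mass_range]. *)
Lemma mass_lt u : 0 < u -> exists n, F (- n%:R) < u.
Proof.
move=> u0; have [n n0 Hn] := exists_nat_sqr (L ('X ^+ 2)) u0; exists n.
have := le_lt_trans (mass_lower_tail n) Hn.
by rewrite ltr_pM2l // exprn_gt0 // ltr0n.
Qed.

Lemma mass_gt u : u < L 1 -> exists n, u < F n%:R.
Proof.
rewrite -subr_gt0 => u0.
have [n n0 Hn] := exists_nat_sqr (L ('X ^+ 2)) u0; exists n.
have := le_lt_trans (mass_upper_tail n) Hn.
by rewrite ltr_pM2l ?exprn_gt0 ?ltr0n // ltrD2l ltrN2.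
Qed.

(** Off this set, [quantile] is the infimum of an empty or unbounded set. *)
Definition mass_range : set R := [set u | exists q r, F q < u <= F r].

Definition quantile u : R := inf [set ratr q | q in [set q | u <= F q]].

Lemma mass_gt_lbound q u : F q < u ->
  lbound [set ratr q | q in [set q | u <= F q]] (ratr q : R).
Proof.
move=> qu _ [r /= ur <-]; rewrite ler_rat leNgt; apply/negP => /ltW /mass_homo.
by move=> /(lt_le_trans (lt_le_trans qu ur)); rewrite ltxx.
Qed.

(** Together with [quantile_le], this confines [quantile u] to [[q, r]] when [F q < u <= F r], which
    is how the integrals below are estimated. *)
Lemma quantile_ge q u : mass_range u -> F q < u -> ratr q <= quantile u.
Proof.
move=> [_ [r /andP[_ ur]]] qu; apply: lb_le_inf; last exact: mass_gt_lbound.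
by exists (ratr r), r.
Qed.

Lemma quantile_le q u : mass_range u -> u <= F q -> quantile u <= ratr q.
Proof.
move=> [r [_ /andP[ru _]]] qu; apply: ge_inf; last by exists q.
by exists (ratr r); apply: mass_gt_lbound.
Qed.

Lemma quantile_homo u v : mass_range u -> mass_range v -> u <= v ->
  quantile u <= quantile v.
Proof.
move=> Uu [q [r /andP[qv vr]]] uv; apply: lb_le_inf.
  by exists (ratr r), r.
by move=> _ [t /= vt <-]; apply: quantile_le => //; apply: le_trans vt.
Qed.

Lemma mass_range_itv : is_interval mass_range.
Proof.
move=> x z [q [_ /andP[qx _]]] [_ [r /andP[_ zr]]] y /andP[xy yz].
by exists q, r; rewrite (lt_le_trans qx xy) (le_trans yz zr).
Qed.

Lemma measurable_mass_range : measurable (mass_range : set (measurableTypeR R)).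
Proof. by apply: is_interval_measurable; apply: mass_range_itv. Qed.

(** By monotonicity, the preimage of a ray [[r, +oo[] is an interval. *)
Lemma measurable_quantile :
  measurable_fun (mass_range : set (measurableTypeR R)) quantile.
Proof.
apply: (measurability (@RGenCInfty.G R)) => [|/= _ [_] [r] -> <-].
  exact: RGenCInfty.measurableE.
apply: is_interval_measurable => x z [Ux rx] [Uz _] y /andP[xy yz].
have Uy : mass_range y by apply: (mass_range_itv Ux Uz); rewrite xy yz.
split => //; move: rx => /=; rewrite !in_itv /= !andbT => rx.
by apply: le_trans rx _; apply: quantile_homo.
Qed.

(** [mass_range] lies between []0, L 1[] and [[0, L 1]], which have the same length. *)
Lemma lebesgue_mass_range : lebesgue_measure mass_range = (L 1)%:E.
Proof.
have M0 : 0 <= L 1 by apply: le_trans (mass_le 0); apply: mass_ge0.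
have mU := measurable_mass_range.
apply/eqP; rewrite eq_le; apply/andP; split.
  have -> : (L 1)%:E = lebesgue_measure `[0, L 1]%classic.
    rewrite lebesgue_measure_itv /= lte_fin; case: ltP => [_|M1].
      by rewrite sube0.
    by have -> : L 1 = 0 by apply/le_anti/andP.
  apply: le_measure; rewrite ?inE //.
  move=> u [q [r /andP[qu ur]]] /=; rewrite in_itv /=.
  by rewrite (le_trans ur (mass_le r)) (ltW (le_lt_trans (mass_ge0 q) qu)).
have -> : (L 1)%:E = lebesgue_measure `]0, L 1[%classic.
  rewrite lebesgue_measure_itv /= lte_fin; case: ltP => [_|M1].
    by rewrite sube0.
  by have -> : L 1 = 0 by apply/le_anti/andP.
apply: le_measure; rewrite ?inE //.
move=> u /=; rewrite in_itv /= => /andP[/mass_lt[n nu] /mass_gt[m um]].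
by exists (- n%:R), m%:R; rewrite nu ltW.
Qed.

(** A lower Riemann-Stieltjes sum: the step function equal to [c j] on []r j, r j.+1]] and to [0]
    elsewhere is below [g], and it is a combination of indicators covered by [LF]. *)
Lemma mass_lower_sum (g : {poly R}) (r : nat -> rat) (c : nat -> R) k :
  (forall x, 0 <= g.[x]) -> {homo r : i j / (i <= j)%N >-> i <= j} ->
  (forall j x, (j < k)%N -> ratr (r j) <= x <= ratr (r j.+1) -> c j <= g.[x]) ->
  \sum_(j < k) c j * (F (r j.+1) - F (r j)) <= L g.
Proof.
move=> g0 r_homo cg.
pose s := flatten [seq [:: (c j, r j.+1); (- c j, r j)] | j <- iota 0 k].
have sE (v : rat -> R) :
    \sum_(i <- s) i.1 * v i.2 = \sum_(j < k) c j * (v (r j.+1) - v (r j)).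
  rewrite big_flatten /= big_map.
  rewrite -(big_mkord xpredT (fun j => c j * (v (r j.+1) - v (r j)))).
  rewrite /index_iota subn0.
  by apply: eq_bigr => j _; rewrite big_cons big_seq1 /=; ring.
rewrite -sE; apply: LF => x; rewrite (sE (fun q => (x <= ratr q)%R%:R)).
(* The indicator on the right strengthens the claim for the induction: for [x] beyond [r k] it
   bounds the earlier terms by [0], and for other [x] the new term vanishes. *)
suff : \sum_(j < k) c j * ((x <= ratr (r j.+1))%R%:R - (x <= ratr (r j))%R%:R)
       <= g.[x] * (x <= ratr (r k))%R%:R.
  by move/le_trans; apply; case: (x <= _); rewrite ?mulr1 ?mulr0.
elim: k cg {s sE} => [|k IH] cg; first by rewrite big_ord0 mulr_ge0.
rewrite big_ord_recr /=.
have {}IH := IH (fun j x jk => cg j x (ltnW jk)).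
have rk : ratr (r k) <= ratr (r k.+1) :> R by rewrite ler_rat r_homo.
move: IH; case: (leP x (ratr (r k))) => [xk|xk] IH.
  by rewrite (le_trans xk rk) subrr mulr0 addr0.
move: IH; rewrite mulr0 subr0 => IH.
rewrite -[leRHS]add0r lerD //; case: (leP x (ratr (r k.+1))) => xk'.
  by rewrite !mulr1 cg // (ltW xk).
by rewrite !mulr0.
Qed.

End QuantileFunction.

(** * Integrals of polynomials along the quantile function *)

Section QuantileIntegral.
Variables (R : realType) (L : {scalar {poly R}}) (F : rat -> R).
Hypothesis LF : forall (s : seq (R * rat)) (p : {poly R}),
  (forall x, \sum_(i <- s) i.1 * (x <= ratr i.2)%R%:R <= p.[x]) ->
  \sum_(i <- s) i.1 * F i.2 <= L p.

Local Notation X := (quantile F).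
Local Notation leb := (@lebesgue_measure R).

Lemma measurable_horner_quantile (p : {poly R}) :
  measurable_fun (mass_range F : set (measurableTypeR R))
    (fun u => (p.[X u])%:E).
Proof.
apply/measurable_EFinP; apply: (measurableT_comp (f := fun x => p.[x])).
  exact: measurable_poly.
exact: measurable_quantile LF.
Qed.

(** Upper counterpart of [mass_lower_sum]: on []F (r j), F (r j.+1)]] the quantile stays in
    [[r j, r j.+1]], and the length of this interval is the increment of [F]. *)
Lemma integral_quantile_upper_sum (g : {poly R}) (r : nat -> rat)
    (C : nat -> R) k :
  (forall x, 0 <= g.[x]) -> {homo r : i j / (i <= j)%N >-> i <= j} ->
  (forall j x, (j < k)%N -> ratr (r j) <= x <= ratr (r j.+1) -> g.[x] <= C j) ->
  (\int[leb]_(u in `]F (r 0%N), F (r k)]) (g.[X u])%:E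
     <= (\sum_(j < k) C j * (F (r j.+1) - F (r j)))%:E)%E.
Proof.
move=> g0 r_homo.
elim: k => [|k IH] gC.
  by rewrite big_ord0 set_itvoc0 integral_set0.
have Frk : F (r k) <= F (r k.+1) by apply/(mass_homo LF)/r_homo.
have F0k : F (r 0%N) <= F (r k) by apply/(mass_homo LF)/r_homo.
have sub j : `]F (r 0%N), F (r j)]%classic `<=` mass_range F.
  by move=> u; rewrite /= in_itv /= => ru; exists (r 0%N), (r j).
rewrite (@itv_bndbnd_setU _ _ _ (BRight (F (r k)))) ?bnd_simp //.
rewrite ge0_integral_setU //=.
- rewrite big_ord_recr /= EFinD leeD //.
    by apply: IH => j x jk; apply: gC; apply: ltn_trans jk _.
  have subk : `]F (r k), F (r k.+1)]%classic `<=` mass_range F.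
    by move=> u; rewrite /= in_itv /= => ru; exists (r k), (r k.+1).
  apply: (@le_trans _ _ (\int[leb]_(u in `]F (r k), F (r k.+1)]) (C k)%:E)%E).
    apply: ge0_le_integral => //.
    + by move=> u _; rewrite lee_fin.
    + apply: measurable_funS (measurable_horner_quantile g) => //.
      exact: measurable_mass_range.
    + move=> u uk; rewrite lee_fin; apply: gC (leqnn _) _.
      move: (uk) => /=; rewrite in_itv /= => /andP[ku uk1].
      rewrite (quantile_ge LF) ?(quantile_le LF) //; exact: subk.
  rewrite integral_cst //= lebesgue_measure_itv /= lte_fin EFinM.
  case: ltP => [_|FF]; first by rewrite EFinB.
  by have -> : F (r k) = F (r k.+1) by [apply/le_anti/andP]; rewrite subrr.
- apply: measurable_funS (measurable_horner_quantile g) => //.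
    exact: measurable_mass_range.
  rewrite -itv_bndbnd_setU ?bnd_simp //.
- by move=> u _; rewrite lee_fin.
- apply/disj_setPS => u [] /=; rewrite !in_itv /= => /andP[_ uk] /andP[ku _].
  by have := le_lt_trans uk ku; rewrite ltxx.
Qed.

Lemma integral_quantile_itv (g : {poly R}) N :
  (forall x, 0 <= g.[x]) ->
  (\int[leb]_(u in `]F (- N%:R), F N%:R]) (g.[X u])%:E <= (L g)%:E)%E.
Proof.
move=> g0; apply/lee_addgt0Pr => e e0.
have M0 : 0 <= L 1 by exact: le_trans (mass_ge0 LF 0) (mass_le LF 0).
pose K := poly_accr_bound g 0 N%:R.
have K0 : 0 < K by apply: poly_accr_bound_gt0.
(* Upper and lower sums will differ by at most [2 * d * (L 1 + 1) = e]; the added [1] keeps the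
   divisor positive when [L 1 = 0]. *)
pose d := e / (2 * (L 1 + 1)).
have d0 : 0 < d by rewrite divr_gt0 // mulr_gt0 // ltr_wpDl.
pose m := (Num.truncn (K / d)).+1.
have Km : K / m%:R <= d.
  by rewrite ler_pdivrMr // mulrC -ler_pdivrMr // ltW // truncnS_gt.
(* A partition of mesh [1 / m] that reaches [N] after [2 * N * m] steps. The Lipschitz constant [K]
   of [g] on [[- N, N]] satisfies [K / m <= d], which controls the oscillation on each cell. *)
pose r (j : nat) : rat := - N%:R + j%:R / m%:R.
have r_homo : {homo r : i j / (i <= j)%N >-> i <= j}.
  by move=> i j ij; rewrite lerD2l ler_pM2r ?invr_gt0 // ler_nat.
have r0 : r 0%N = - N%:R by rewrite /r mul0r addr0.
have rk : r (2 * N * m)%N = N%:R.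
  by rewrite /r natrM mulfK ?pnatr_eq0 // natrM; ring.
have osc j x : (j < 2 * N * m)%N -> ratr (r j) <= x <= ratr (r j.+1) ->
    `|g.[x] - g.[ratr (r j)]| <= d.
  move=> jk /andP[rx xr].
  have lo : - N%:R <= ratr (r j) :> R.
    by rewrite -(ratr_nat _ N) -rmorphN /= -r0 ler_rat r_homo.
  have hi : ratr (r j.+1) <= N%:R :> R.
    by rewrite -(ratr_nat _ N) -rk ler_rat r_homo.
  apply: le_trans (@poly_accr_bound1P _ g 0 N%:R _ _ _ _) _.
  - by rewrite subr0 ler_norml lo (le_trans (le_trans rx xr)).
  - by rewrite subr0 ler_norml (le_trans lo rx) (le_trans xr).
  have : `|x - ratr (r j)| <= m%:R^-1.
    rewrite ger0_norm ?subr_ge0 // lerBlDl (le_trans xr) //.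
    rewrite /r -natr1 mulrDl addrA rmorphD /= mul1r fmorphV /= ratr_nat.
    by rewrite lexx.
  by rewrite -(ler_pM2r K0) => /le_trans; apply; rewrite mulrC.
(* On the cell of index [j], [g] lies between [c j] and [c j + 2 * d]. *)
pose c j := Num.max 0 (g.[ratr (r j)] - d).
have low : \sum_(j < 2 * N * m) c j * (F (r j.+1) - F (r j)) <= L g.
  apply: (mass_lower_sum LF) => // j x jk rx.
  by rewrite ge_max g0; have := osc j x jk rx; rewrite ler_norml; lra.
have := @integral_quantile_upper_sum g r (fun j => c j + 2 * d)
  (2 * N * m) g0 r_homo.
rewrite r0 rk => up; apply: le_trans (up _) _ => [j x jk rx|].
  have := osc j x jk rx; rewrite ler_norml.
  have : g.[ratr (r j)] - d <= c j by rewrite le_max lexx orbT.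
  lra.
rewrite -EFinD lee_fin.
under eq_bigr do rewrite mulrDl.
rewrite big_split /= -mulr_sumr lerD //.
have -> : \sum_(j < 2 * N * m) (F (r j.+1) - F (r j)) = F N%:R - F (- N%:R).
  rewrite -(big_mkord xpredT (fun j => F (r j.+1) - F (r j))).
  by rewrite (telescope_sumr (fun j => F (r j))) // rk r0.
have FM : F N%:R - F (- N%:R) <= L 1 + 1.
  by have := mass_le LF N%:R; have := mass_ge0 LF (- N%:R); lra.
have -> : e = 2 * d * (L 1 + 1).
  by rewrite /d; field; rewrite gt_eqF // ltr_wpDl.
by rewrite ler_pM2l // mulr_gt0.
Qed.

Lemma bigcup_mass_itv :
  \bigcup_N `]F (- N%:R), F N%:R]%classic = mass_range F.
Proof.
apply/seteqP; split=> [u [N _] /=|u [q [r /andP[qu ur]]]].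
  by rewrite in_itv /= => H; exists (- N%:R), N%:R.
exists (Num.truncn (`|q| + `|r|)).+1 => //=; rewrite in_itv /=.
have := truncnS_gt (`|q| + `|r|); set N := (_ .+1)%:R => HN.
have rN : r <= N by have := ler_norm r; have := normr_ge0 q; lra.
have qN : - N <= q.
  by have := ler_norm (- q); rewrite normrN; have := normr_ge0 r; lra.
by rewrite (le_lt_trans (mass_homo LF qN)) // (le_trans ur) // (mass_homo LF).
Qed.

(** Monotone convergence along the exhaustion [bigcup_mass_itv]. *)
Lemma integral_quantile (g : {poly R}) : (forall x, 0 <= g.[x]) ->
  (\int[leb]_(u in mass_range F) (g.[X u])%:E <= (L g)%:E)%E.
Proof.
move=> g0; rewrite -bigcup_mass_itv.
have sub N : `]F (- N%:R), F N%:R]%classic `<=` mass_range F.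
  by rewrite -bigcup_mass_itv => u Nu; exists N.
have cvgI :
    (\int[leb]_(u in `]F (- N%:R), F N%:R]) (g.[X u])%:E @[N --> \oo] -->
    \int[leb]_(u in \bigcup_N `]F (- N%:R), F N%:R]%classic) (g.[X u])%:E)%E.
  apply: (@ge0_nondecreasing_set_cvg_integral _ (measurableTypeR R)).
  - move=> i j ij; rewrite subsetEset => u /=; rewrite !in_itv /=.
    move=> /andP[iu ui].
    have ij' : i%:R <= j%:R :> rat by rewrite ler_nat.
    rewrite (le_trans ui (mass_homo LF ij')) andbT.
    by apply: le_lt_trans iu; apply: (mass_homo LF); rewrite lerN2.
  - by move=> N; apply: measurable_itv.
  - move=> N; apply: measurable_funS (measurable_horner_quantile g) => //.
    exact: measurable_mass_range.
  - by move=> N u _; rewrite lee_fin.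
rewrite -(cvg_lim _ cvgI) //; apply: lime_le; first exact: cvgP cvgI.
by apply: nearW => N; apply: integral_quantile_itv.
Qed.

End QuantileIntegral.

(** * The image of Lebesgue measure under the quantile function *)

Section QuantileLaw.
Variables (R : realType) (L : {scalar {poly R}}) (F : rat -> R).
Hypothesis LF : forall (s : seq (R * rat)) (p : {poly R}),
  (forall x, \sum_(i <- s) i.1 * (x <= ratr i.2)%R%:R <= p.[x]) ->
  \sum_(i <- s) i.1 * F i.2 <= L p.

Local Notation leb := (@lebesgue_measure R).
Local Notation U := (mass_range F : set (measurableTypeR R)).

Let mU : measurable U := measurable_mass_range F.

(** Extension by [0] gives a measurable map on the whole line; restricting Lebesgue measure to [U],
    in [lebU], keeps the artificial values from adding mass at [0]. *)
Let X : measurableTypeR R -> measurableTypeR R := quantile F \_ U.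

Let mX : measurable_fun setT X.
Proof.
by apply: (measurable_restrictT _ mU).1; exact: measurable_quantile LF.
Qed.

Let lebU : {measure set (measurableTypeR R) -> \bar R} := mrestr leb mU.

Let law : set (measurableTypeR R) -> \bar R := pushforward lebU X.

Let law0 : law set0 = 0%E. Proof. exact: measure0. Qed.

Let law_ge0 A : (0 <= law A)%E. Proof. exact: measure_ge0. Qed.

Let law_sigma_additive : semi_sigma_additive law.
Proof. exact: measure_semi_sigma_additive. Qed.

HB.instance Definition _ := isMeasure.Build _ _ _ law
  law0 law_ge0 law_sigma_additive.

Let integral_law (h : R -> R) :
  measurable_fun (setT : set (measurableTypeR R)) h -> (forall x, 0 <= h x) ->
  (\int[law]_x (h x)%:E =
   \int[leb]_(u in mass_range F) (h (quantile F u))%:E)%E.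
Proof.
move=> mh h0.
have mhE : measurable_fun (setT : set (measurableTypeR R)) (EFin \o h).
  exact/measurable_EFinP.
have mhX : measurable_fun setT (EFin \o h \o X) by exact: measurableT_comp.
have -> : (\int[law]_x (h x)%:E = \int[lebU]_u (h (X u))%:E)%E.
  by rewrite ge0_integral_pushforward // => x _; rewrite lee_fin.
(* The complement of [U] is null for [lebU], and inside [U] the measures [lebU] and [leb] agree. *)
rewrite -(setvU U) ge0_integral_setU //; last 4 first.
- exact: measurableC.
- by rewrite setvU; exact: mhX.
- by move=> u _; rewrite lee_fin.
- by apply/disj_setPS; rewrite setICl.
rewrite (@eq_measure_integral _ _ _ _ mzero) => [|A mA AU]; last first.
  rewrite /lebU /= /mrestr; have -> : A `&` U = set0 by apply/disjoints_subset.
  exact: measure0.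
rewrite integral_measure_zero add0e.
rewrite (@eq_measure_integral _ _ _ _ leb) => [|A mA AU]; last first.
  by rewrite /lebU /= /mrestr setIidl.
by apply: eq_integral => u uU; rewrite /X patchE uU.
Qed.

Lemma exists_quantile_law :
  exists mu : {measure set (measurableTypeR R) -> \bar R},
  mu setT = (L 1)%:E /\
  forall g : {poly R}, (forall x, 0 <= g.[x]) ->
    (\int[mu]_x (g.[x])%:E <= (L g)%:E)%E.
Proof.
exists law; split.
  by have := lebesgue_mass_range LF; rewrite -[X in lebesgue_measure X]setTI.
move=> g g0; rewrite integral_law //; last exact: measurable_poly.
exact: integral_quantile.
Qed.

End QuantileLaw.

(** * Hamburger's theorem *)

(** Cauchy-Schwarz for the form [(p, q) |-> (L - I) (p * q)], with [q = 1]. *)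
Lemma eq_linear_of_square_le (R : realFieldType) (L I : {scalar {poly R}}) :
  I 1 = L 1 -> (forall p, I (p ^+ 2) <= L (p ^+ 2)) -> forall p, I p = L p.
Proof.
move=> I1 IL p; pose D q := L q - I q.
(* Since [D 1 = 0], the term in [t ^+ 2] disappears; an affine function of [t] that is never
   negative has slope zero. *)
have quad t : 0 <= D (p ^+ 2) + 2 * t * D p.
  have : 0 <= D ((p + t *: 1) ^+ 2) by rewrite subr_ge0.
  have -> : (p + t *: 1) ^+ 2 = p ^+ 2 + (2 * t) *: p + t ^+ 2 *: 1.
    by rewrite -!mul_polyC !polyCM polyC_natr; ring.
  rewrite /D !linearD ![L (_ *: _)]linearZ ![I (_ *: _)]linearZ /= I1; lra.
apply/eqP; rewrite eq_sym -subr_eq0 -/(D p); apply/negP => /negP Dp.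
(* At this [t] the affine function takes the value [-1]. *)
have := quad (- (D (p ^+ 2) + 1) / (2 * D p)).
have -> : 2 * (- (D (p ^+ 2) + 1) / (2 * D p)) * D p = - (D (p ^+ 2) + 1).
  by field.
by rewrite opprD addNKr; lra.
Qed.

Lemma hamburger_poly (R : realType) (L : {scalar {poly R}}) :
  (forall p, 0 <= L (p ^+ 2)) ->
  exists mu : {measure set (measurableTypeR R) -> \bar R}, forall p : {poly R},
    mu.-integrable setT (fun x => (p.[x])%:E) /\ L p = \int[mu]_x p.[x].
Proof.
move=> L0.
have Lpos p : (forall x, 0 <= p.[x]) -> 0 <= L p.
  move=> /nonneg_poly_sum_squares[s ->].
  by rewrite linear_sum sumr_ge0.
have bnd (q : rat) :
    exists p : {poly R}, forall x, `|(x <= ratr q)%R%:R| <= p.[x].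
  by exists 1 => x; rewrite hornerC normr_nat lern1 leq_b1.
have [F LF] := dominated_values_count bnd Lpos.
have [mu [mu1 muL]] := exists_quantile_law LF.
have mE (p : {poly R}) :
    measurable_fun (setT : set (measurableTypeR R)) (fun x => (p.[x])%:E).
  by apply/measurable_EFinP; exact: measurable_poly.
have int_nonneg g : (forall x, 0 <= g.[x]) ->
    mu.-integrable setT (fun x => (g.[x])%:E).
  move=> g0; apply/integrableP; split=> //.
  under eq_integral do rewrite gee0_abs ?lee_fin //.
  by apply: le_lt_trans (muL g g0) _; rewrite ltry.
(* The absolute value of [p] is at most [1 + p ^+ 2], a non-negative polynomial. *)
have int p : mu.-integrable setT (fun x => (p.[x])%:E).
  apply: (@le_integrable _ _ _ mu setT measurableT _
    (fun x => ((1 + p ^+ 2).[x])%:E)) => //.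
    move=> x _; rewrite /= lee_fin !hornerE.
    rewrite [leRHS]ger0_norm ?addr_ge0 ?sqr_ge0 // ler_norml.
    by have := sqr_ge0 (p.[x] + 1); have := sqr_ge0 (p.[x] - 1); nra.
  by apply: int_nonneg => x; rewrite !hornerE addr_ge0 ?sqr_ge0.
pose I (p : {poly R}) := (\int[mu]_x p.[x])%R.
have linI : scalar I.
  move=> a p q; rewrite /I; under eq_Rintegral do rewrite hornerD hornerZ.
  have intZ : mu.-integrable setT (EFin \o (fun x => a * p.[x])).
    rewrite (_ : _ \o _ = fun x => ((a *: p).[x])%:E) //.
    by apply/funext => x /=; rewrite hornerZ.
  rewrite (RintegralD measurableT intZ (int q)).
  by rewrite (RintegralZl _ measurableT (int p)).
pose I' : {scalar {poly R}} :=
  HB.pack I (GRing.isLinear.Build R {poly R} R *%R I linI).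
exists mu => p; split=> //.
apply/esym/(@eq_linear_of_square_le _ L I') => /= [|q].
  rewrite /I; under eq_Rintegral do rewrite hornerC.
  by rewrite Rintegral_cst // mu1 mul1r.
have q0 x : 0 <= (q ^+ 2).[x] by rewrite hornerE sqr_ge0.
rewrite -lee_fin /I fineK; first exact: muL.
by apply: integrable_fin_num.
Qed.

(** * The star product on finite sequences *)

Local Open Scope complex_scope.

Section Coordinates.
Variables (R : realType) (P : nat -> {poly R}).
Hypothesis degP : forall n, size (P n) = n.+1.

Lemma I_P_inv_coord (a : nat -> R[i]) N n :
  I_P_inv P (\sum_(k < N) a k *: complexify (P k)) n =
  if (n < N)%N then a n else 0.
Proof.
pose f : l_fin R := [fsfun n in [fset k in iota 0 N]%fset => a n].
have fE k : f k = if (k < N)%N then a k else 0.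
  by rewrite /f fsfunE !inE mem_iota add0n.
rewrite -fE; congr (fun_of_fsfun _ _); rewrite -[RHS](I_PK degP).
congr (I_P_inv P _); rewrite (@I_P_ord _ _ f N) => [|k].
  by apply: eq_bigr => k _; rewrite fE ltn_ord.
by rewrite fE ltnNge => ->.
Qed.

Lemma I_P_inv_linear (c : R[i]) (p q : {poly R[i]}) n :
  I_P_inv P (c *: p + q) n = c * I_P_inv P p n + I_P_inv P q n.
Proof.
pose N := maxn (size p) (size q).
have [a ->] := basis_gen degP (leq_maxl _ _ : (size p <= N)%N).
have [b ->] := basis_gen degP (leq_maxr _ _ : (size q <= N)%N).
have -> : c *: \sum_(k < N) a k *: complexify (P k) +
    \sum_(k < N) b k *: complexify (P k) =
    \sum_(k < N) (c * a k + b k) *: complexify (P k).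
  rewrite scaler_sumr -big_split; apply: eq_bigr => k _ /=.
  by rewrite scalerDl scalerA.
rewrite (I_P_inv_coord (fun k => c * a k + b k)) !I_P_inv_coord.
by case: ifP => // _; rewrite mulr0 addr0.
Qed.

Lemma I_P_inv_sum (I : finType) (c : I -> R[i]) (p : I -> {poly R[i]}) n :
  I_P_inv P (\sum_i c i *: p i) n = \sum_i c i * I_P_inv P (p i) n.
Proof.
apply: (big_ind2 (fun q z => I_P_inv P q n = z)).
- by have := I_P_inv_coord (fun=> 0) 0 n; rewrite big_ord0.
- by move=> q z q' z' <- <-; rewrite -[q]scale1r I_P_inv_linear mul1r scale1r.
- move=> i _; rewrite -[c i *: p i]addr0 I_P_inv_linear.
  by have := I_P_inv_coord (fun=> 0) 0 n; rewrite big_ord0 => ->; rewrite addr0.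
Qed.

Lemma dotP_coord (q : {poly R[i]}) n :
  dotP P q (complexify (P n)) = I_P_inv P q n.
Proof.
have coord k : I_P_inv P (complexify (P n)) k = (k == n)%:R.
  have := I_P_inv_coord (fun k => (k == n)%:R) n.+1 k.
  rewrite big_ord_recr /= eqxx scale1r big1 ?add0r => [->|j _]; last first.
    by rewrite ltn_eqF // scale0r.
  by case: ltnP => // nk; rewrite gtn_eqF.
rewrite /dotP (@fsbig_lfin _ n.+1) => [|k nk]; last first.
  by rewrite coord gtn_eqF // rmorph_nat mulr0.
rewrite big_ord_recr /= coord eqxx rmorph1 mulr1 big1 ?add0r // => j _.
by rewrite coord ltn_eqF // rmorph_nat mulr0.
Qed.

Lemma I_P_inv_bound (q : {poly R[i]}) n : (size q <= n)%N -> I_P_inv P q n = 0.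
Proof.
move=> qn; have [a ->] := basis_gen degP (leqnn (size q)).
by rewrite I_P_inv_coord ltnNge qn.
Qed.

(** Bilinearity of the product, once [f] and its conjugate are expanded up to a common bound [N] of
    their supports. *)
Lemma star_coord (f : l_fin R) n :
  star P f (conj_fin f) n =
  \sum_(j \in [set: nat]) \sum_(k \in [set: nat])
    f j * (f k)^* * dotP P (complexify (P j) * complexify (P k)) (complexify (P n)).
Proof.
have cE k : conj_fin f k = Num.conj (f k) := conj_finE f k.
have [N fN] := lfin_bound f.
have fcN k : (N <= k)%N -> conj_fin f k = 0.
  by move=> /fN; rewrite cE => ->; rewrite rmorph0.
rewrite (@fsbig_lfin _ N) => [|j /fN ->]; last first.
  by rewrite fsbig1 // => k _; rewrite !mul0r.
under eq_bigr => j _.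
  rewrite (@fsbig_lfin _ N) => [|k /fN ->]; last by rewrite rmorph0 mulr0 mul0r.
  under eq_bigr => k _ do rewrite dotP_coord -cE -mulrA.
  over.
rewrite /star (I_P_ord P fN) (I_P_ord P fcN) mulr_suml.
under [in LHS]eq_bigr => j _ do rewrite -scalerAl.
rewrite I_P_inv_sum; apply: eq_bigr => j _; rewrite -mulr_sumr; congr (_ * _).
rewrite mulr_sumr; under eq_bigr => k _ do rewrite -scalerAr.
by rewrite I_P_inv_sum.
Qed.

(** [tau] carried over to polynomials: the linear form with value [tau n] at [P n]. It turns the
    star product into the ordinary product. *)
Definition star_functional (tau : nat -> R[i]) (q : {poly R[i]}) : R[i] :=
  functional tau (I_P_inv P q).

Lemma star_functional_bound tau (q : {poly R[i]}) N : (size q <= N)%N ->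
  star_functional tau q = \sum_(n < N) tau n * I_P_inv P q n.
Proof.
move=> qN; apply: fsbig_lfin => n Nn.
by rewrite I_P_inv_bound ?mulr0 // (leq_trans qN).
Qed.

Lemma star_functional_linear tau c (p q : {poly R[i]}) :
  star_functional tau (c *: p + q) =
  c * star_functional tau p + star_functional tau q.
Proof.
pose N := maxn (size p) (size q).
have pN : (size p <= N)%N by apply: leq_maxl.
have qN : (size q <= N)%N by apply: leq_maxr.
rewrite !(@star_functional_bound _ _ N) //; last first.
  rewrite (leq_trans (size_polyD _ _)) // geq_max qN andbT.
  exact: leq_trans (size_scale_leq _ _) pN.
rewrite mulr_sumr -big_split; apply: eq_bigr => k _ /=.
by rewrite I_P_inv_linear mulrDr mulrCA.
Qed.

Lemma star_functional_basis tau n :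
  star_functional tau (complexify (P n)) = tau n.
Proof.
rewrite (@star_functional_bound _ _ n.+1) ?size_map_poly ?degP //.
under eq_bigr do rewrite -dotP_coord dotP_orthonormal //.
rewrite big_ord_recr /= eqxx mulr1 big1 ?add0r // => k _.
by rewrite gtn_eqF // mulr0.
Qed.

(** Taking real parts of complex coordinates is harmless because [r] and all [P n] have real
    coefficients. *)
Lemma real_basis_gen (r : {poly R}) :
  exists a : nat -> R, r = \sum_(n < size r) a n *: P n.
Proof.
have sc : (size (complexify r) <= size r)%N by rewrite size_map_poly.
have [a ra] := basis_gen degP sc.
exists (fun n => complex.Re (a n)); apply/polyP => k.
have := congr1 (fun q : {poly R[i]} => complex.Re q`_k) ra.
rewrite coef_map /= => ->; rewrite !coef_sum.
rewrite (big_morph (@complex.Re R) (id1 := 0) (op1 := +%R)) //; last first.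
  by case=> ? ? [].
apply: eq_bigr => n _; rewrite !coefZ coef_map /=.
by case: (a n) => x y /=; rewrite mulr0 subr0.
Qed.

End Coordinates.

Lemma complexifyD (R : realType) (p q : {poly R}) :
  complexify (p + q) = complexify p + complexify q.
Proof. by rewrite /complexify rmorphD. Qed.

Lemma complexifyM (R : realType) (p q : {poly R}) :
  complexify (p * q) = complexify p * complexify q.
Proof. by rewrite /complexify rmorphM. Qed.

Lemma complexifyZ (R : realType) (a : R) (p : {poly R}) :
  complexify (a *: p) = a%:C *: complexify p.
Proof. by rewrite /complexify map_polyZ. Qed.

Lemma complexify_sum (R : realType) (a : nat -> R) (p : nat -> {poly R}) N :
  complexify (\sum_(n < N) a n *: p n) =
  \sum_(n < N) (a n)%:C *: complexify (p n).
Proof.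
rewrite {1}/complexify rmorph_sum; apply: eq_bigr => n _; exact: complexifyZ.
Qed.

(** * Equivalence of star-positivity and the moment property *)

Section StarPositivity.
Variables (R : realType) (P : nat -> {poly R}).
Hypothesis degP : forall n, size (P n) = n.+1.
Variable tau : nat -> R[i].

Local Notation T := (star_functional P tau).

(** The [P n] being real, the real and imaginary parts of [f] give [u] and [v] with
    [(u + i v) (u - i v) = u ^+ 2 + v ^+ 2]. *)
Lemma I_P_mul_conj (f : l_fin R) : exists u v : {poly R},
  I_P P f * I_P P (conj_fin f) = complexify (u * u + v * v).
Proof.
have [N fN] := lfin_bound f.
have fcN k : (N <= k)%N -> conj_fin f k = 0.
  by move=> /fN; rewrite conj_finE => ->; apply: conjc0.
pose u := \sum_(n < N) complex.Re (f n) *: P n.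
pose v := \sum_(n < N) complex.Im (f n) *: P n.
exists u, v.
have -> : I_P P f = complexify u + 'i%C *: complexify v.
  rewrite (I_P_ord P fN) (complexify_sum (fun n => complex.Re (f n))).
  rewrite (complexify_sum (fun n => complex.Im (f n))) scaler_sumr -big_split.
  by apply: eq_bigr => n _ /=; rewrite scalerA -scalerDl -complexE.
have -> : I_P P (conj_fin f) = complexify u - 'i%C *: complexify v.
  rewrite (I_P_ord P fcN) (complexify_sum (fun n => complex.Re (f n))).
  rewrite (complexify_sum (fun n => complex.Im (f n))) scaler_sumr -sumrB.
  apply: eq_bigr => n _ /=; rewrite scalerA -scalerBl conj_finE; congr (_ *: _).
  by case: (f n) => x y; simpc.
rewrite complexifyD !complexifyM -!mul_polyC.
have ii : ('i%C)%:P * ('i%C)%:P = -1 :> {poly R[i]}.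
  by rewrite -polyCM -expr2 sqr_i polyCN.
transitivity (complexify u * complexify u -
   (('i%C)%:P * ('i%C)%:P) * (complexify v * complexify v)); first by ring.
by rewrite ii mulN1r opprK.
Qed.

Lemma star_functional_sum (a : nat -> R) N :
  T (complexify (\sum_(n < N) a n *: P n)) = \sum_(n < N) (a n)%:C * tau n.
Proof.
rewrite complexify_sum; elim: N => [|N IH].
  by rewrite !big_ord0 (@star_functional_bound _ _ degP _ _ 0) ?size_poly0 //
    big_ord0.
rewrite !big_ord_recr /= addrC [RHS]addrC star_functional_linear // IH.
by rewrite star_functional_basis.
Qed.

(** By [I_P_mul_conj], the value in question is the integral of a sum of two squares. *)
Lemma moment_star_positive : moment_functional P tau -> star_positive P tau.
Proof.
move=> [mu Hmu] f; rewrite /star.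
have [u [v ->]] := I_P_mul_conj f.
rewrite -/(star_functional P tau _).
set g := u * u + v * v.
have [a ga] := real_basis_gen degP g.
(* Integrability and value go through one induction, since additivity of the integral requires
   integrable summands. *)
have sums N :
    mu.-integrable setT (EFin \o (fun x => (\sum_(n < N) a n *: P n).[x])) /\
    \sum_(n < N) (a n)%:C * tau n =
    (\int[mu]_x (\sum_(n < N) a n *: P n).[x])%:C.
  elim: N => [|N [intS IH]].
    rewrite !big_ord0; split.
      under [X in _.-integrable _ X]eq_fun do rewrite /= horner0.
      exact: integrable0.
    under eq_Rintegral do rewrite horner0.
    by rewrite Rintegral_cst // mul0r.
  have [intP tauE] := Hmu N.
  have intZ : mu.-integrable setT (EFin \o (fun x => a N * (P N).[x])).
    have -> : EFin \o (fun x => a N * (P N).[x]) =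
        (fun x => (a N)%:E * ((P N).[x])%:E)%E.
      by apply/funext => x; rewrite /= EFinM.
    exact: integrableZl.
  rewrite !big_ord_recr /=; split.
    have -> : EFin \o (fun x => (\sum_(n < N) a n *: P n + a N *: P N).[x]) =
      ((EFin \o (fun x => (\sum_(n < N) a n *: P n).[x])%R) \+
       (EFin \o (fun x => a N * (P N).[x])%R))%E.
      by apply/funext => x; rewrite /= hornerD hornerZ EFinD.
    exact: integrableD.
  under eq_Rintegral do rewrite hornerD hornerZ.
  rewrite (RintegralD measurableT intS intZ) (RintegralZl _ measurableT intP).
  by rewrite IH tauE rmorphD rmorphM.
have [_ Tg] := sums (size g).
rewrite ga star_functional_sum Tg -ga ler0c /Rintegral fine_ge0 //.
rewrite integral_ge0 // => x _.
by rewrite lee_fin !hornerE -!expr2 addr_ge0 ?sqr_ge0.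
Qed.

(** A real polynomial has real coordinates, so its coordinate sequence is its own conjugate. *)
Lemma star_positive_sqr (p : {poly R}) : star_positive P tau ->
  0 <= T (complexify (p ^+ 2)).
Proof.
move=> pos; have [a pa] := real_basis_gen degP p.
pose f := I_P_inv P (complexify p).
have fE n : f n = (if (n < size p)%N then a n else 0)%:C.
  rewrite /f {1}pa complexify_sum.
  by rewrite (I_P_inv_coord degP (fun k => (a k)%:C)); case: ifP.
have cf : conj_fin f = f.
  by apply/fsfunP => n; rewrite conj_finE fE conjc_real.
have := pos f; rewrite cf /star (I_P_invK degP) -complexifyM -expr2.
exact.
Qed.

Lemma star_positive_moment : star_positive P tau -> moment_functional P tau.
Proof.
move=> pos.
have TZ (c : R) (p q : {poly R}) :
    T (complexify (c *: p + q)) = c%:C * T (complexify p) + T (complexify q).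
  by rewrite complexifyD complexifyZ star_functional_linear.
pose L (p : {poly R}) := complex.Re (T (complexify p)).
have linL : scalar L.
  move=> c p q; rewrite /L TZ.
  case: (T (complexify p)) => x y; case: (T _) => x' y' /=.
  by rewrite mul0r subr0.
have sqr_real p : complex.Im (T (complexify (p ^+ 2))) = 0 /\ 0 <= L (p ^+ 2).
  have := star_positive_sqr p pos; rewrite lecE => /andP[/eqP ? ?].
  by split.
(* Polarization: [2 p = (p + 1) ^+ 2 - p ^+ 2 - 1], and squares have real values. Hence taking the
   real part in [L] loses nothing. *)
have Im0 p : complex.Im (T (complexify p)) = 0.
  have := (sqr_real (p + 1)).1; have := (sqr_real p).1; have := (sqr_real 1).1.
  have -> : (p + 1) ^+ 2 = 1 *: p ^+ 2 + (2 *: p + 1 ^+ 2).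
    by rewrite scale1r -mul_polyC polyC_natr; ring.
  rewrite !TZ.
  case: (T (complexify (1 ^+ 2))) => x1 y1.
  case: (T (complexify (p ^+ 2))) => x2 y2.
  by case: (T (complexify p)) => x y /=; lra.
pose L' : {scalar {poly R}} :=
  HB.pack L (GRing.isLinear.Build R {poly R} R *%R L linL).
have [mu Hmu] := @hamburger_poly _ L' (fun p => (sqr_real p).2).
exists mu => n; have [intP LP] := Hmu (P n); split=> //.
rewrite -LP /= /L -(star_functional_basis degP tau n).
by move: (Im0 (P n)); case: (T _) => x y /= ->.
Qed.

End StarPositivity.

Unset Implicit Arguments.

Theorem theorem4p2 (R : realType) (P : nat -> {poly R})
    (degP : forall n, size (P n) = n.+1) (tau : nat -> R[i]) :
  (moment_functional P tau <-> star_positive P tau) /\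
  (forall f : l_fin R,
     functional tau (star P f (conj_fin f)) =
     \sum_(n \in [set: nat]) tau n *
       (\sum_(j \in [set: nat]) \sum_(k \in [set: nat])
          f j * (f k)^* * dotP P (complexify (P j) * complexify (P k)) (complexify (P n)))).
Proof.
split=> [|f]; first split.
- exact: moment_star_positive.
- exact: star_positive_moment.
- by apply: eq_fsbigr => n _; rewrite star_coord.
Qed.
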